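(* Let $n\ge 1$ be an integer. If $n$ is odd, then $\operatorname{Re} V^n$ has at most $n$ non-zero eigenvalues. If $n$ is even, then $\operatorname{Im} V^n$ has at most $n$ non-zero eigenvalues.
   Context: $L^2[0,1]$ is the complex Hilbert space of square-integrable functions on $[0,1]$. The Volterra operator $V:L^2[0,1]\to L^2[0,1]$ is defined by $Vf(x):=\int_0^x f(t)\,dt$, and its adjoint is $V^*f(x)=\int_x^1 f(t)\,dt$. For $n\ge1$, write $V^{*n}:=(V^* )^n$, $\operatorname{Re} V^n:=(V^n+V^{*n})/2$ and $\operatorname{Im} V^n:=(V^n-V^{*n})/(2i)$. *)

(* Defs.v *)
From HB Require Import structures.
From mathcomp Require Import all_boot all_order all_algebra.
From mathcomp Require Import generic_quotient ring_quotient complex.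
From mathcomp Require Import ring lra.
From mathcomp Require Import all_classical all_reals all_analysis.
From mathcomp Require Import measurable_realfun.

Set Implicit Arguments.
Unset Strict Implicit.
Unset Printing Implicit Defensive.

Import Order.TTheory GRing.Theory Num.Theory.
Import numFieldNormedType.Exports.

Local Open Scope classical_set_scope.
Local Open Scope ring_scope.
Local Open Scope quotient_scope.
Local Open Scope complex_scope.

(* Real-valued parts of a complex number (Num.Theory shadows these names). *)
Local Notation Re := complex.Re.
Local Notation Im := complex.Im.

Section L2.
Variable R : realType.
Notation mu := (@lebesgue_measure R).
Notation I01 := (`[0, 1]%classic : set R).

(* The values of f outside [0, 1] are irrelevant.  The regular algebra [R[i]^o]
   selects the complex (rather than real) scalar multiplication on values.
   A complex function is measurable when its real and imaginary parts are. *)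
Definition sq_integrable (f : R -> R[i]^o) : Prop :=
  [/\ measurable_fun I01 (fun x => Re (f x)),
      measurable_fun I01 (fun x => Im (f x)) &
      mu.-integrable I01 (fun x => (Re (f x) ^+ 2 + Im (f x) ^+ 2)%:E)].

Definition L2pred : {pred R -> R[i]^o} := [pred f | `[< sq_integrable f >]].

Lemma L2predP (f : R -> R[i]^o) : reflect (sq_integrable f) (f \in L2pred).
Proof. exact: asboolP. Qed.

Lemma ReM (a b : R[i]) : Re (a * b) = Re a * Re b - Im a * Im b.
Proof. by case: a; case: b. Qed.

Lemma ImM (a b : R[i]) : Im (a * b) = Re a * Im b + Im a * Re b.
Proof. by case: a; case: b. Qed.

Lemma ReDc (a b : R[i]) : Re (a + b) = Re a + Re b.
Proof. by case: a; case: b. Qed.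

Lemma ImDc (a b : R[i]) : Im (a + b) = Im a + Im b.
Proof. by case: a; case: b. Qed.

Lemma L2_submod_closed : submod_closed L2pred.
Proof.
split.
  apply/L2predP; split => /=; try exact: measurable_cst.
  apply: eq_integrable (integrable0 mu I01) => // x _ /=.
  by rewrite expr0n /= addr0.
move=> a f g /L2predP[fr fi f2] /L2predP[gr gi g2].
have mr : measurable_fun I01 (fun x => Re ((a *: f + g) x)).
  rewrite (_ : (fun x => _) = (fun x => (Re a * Re (f x) - Im a * Im (f x))
     + Re (g x))); last by apply/funext => x; rewrite ReDc ReM.
  apply: measurable_funD => //.
  by apply: measurable_funB; apply: measurable_funM.
have mi : measurable_fun I01 (fun x => Im ((a *: f + g) x)).
  rewrite (_ : (fun x => _) = (fun x => (Re a * Im (f x) + Im a * Re (f x))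
     + Im (g x))); last by apply/funext => x; rewrite ImDc ImM.
  apply: measurable_funD => //.
  by apply: measurable_funD; apply: measurable_funM.
apply/L2predP; split => //.
have i1 : mu.-integrable I01
  (fun x => (2 * (Re a ^+ 2 + Im a ^+ 2))%:E * (Re (f x) ^+ 2 + Im (f x) ^+ 2)%:E
    + 2%:E * (Re (g x) ^+ 2 + Im (g x) ^+ 2)%:E)%E.
  by apply: integrableD => //; apply: integrableZl.
apply: (le_integrable _ _ _ i1) => //.
- apply/measurable_EFinP; apply: measurable_funD; exact: measurable_funX.
- move=> x _; rewrite -!EFinM -EFinD !abse_EFin lee_fin.
  rewrite ger0_norm ?addr_ge0 ?sqr_ge0//.
  apply: le_trans (ler_norm _).
  rewrite ReDc ImDc ReM ImM.
  set a1 := Re a; set a2 := Im a; set u := Re _; set v := Im _.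
  set p := Re _; set q := Im _.
  rewrite -subr_ge0.
  suff -> : 2 * (a1 ^+ 2 + a2 ^+ 2) * (u ^+ 2 + v ^+ 2) + 2 * (p ^+ 2 + q ^+ 2) -
     ((a1 * u - a2 * v + p) ^+ 2 + (a1 * v + a2 * u + q) ^+ 2) =
     (a1 * u - a2 * v - p) ^+ 2 + (a1 * v + a2 * u - q) ^+ 2.
    by rewrite addr_ge0 ?sqr_ge0.
  ring.
Qed.

HB.instance Definition _ :=
  GRing.isSubmodClosed.Build _ _ L2pred L2_submod_closed.

Record L2fun := MkL2fun { L2val :> R -> R[i]^o; L2valP : L2val \in L2pred }.

HB.instance Definition _ := [isSub for L2val].
HB.instance Definition _ := [Choice of L2fun by <:].
HB.instance Definition _ := [SubChoice_isSubLmodule of L2fun by <:].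

Lemma ae_imp2 (P Q S : R -> Prop) : (forall x, P x -> Q x -> S x) ->
  (\forall x \ae mu, P x) -> (\forall x \ae mu, Q x) -> \forall x \ae mu, S x.
Proof.
by move=> PQS; apply: (@filterS2 _ _ (ae_filter_ringOfSetsType mu)).
Qed.

Lemma ae_imp (P S : R -> Prop) : (forall x, P x -> S x) ->
  (\forall x \ae mu, P x) -> \forall x \ae mu, S x.
Proof. by move=> PS; apply: (@filterS _ _ (ae_filter_ringOfSetsType mu)). Qed.

Definition L2null : {pred L2fun} :=
  [pred f : L2fun | `[< \forall x \ae mu, I01 x -> f x = 0 >]].

Lemma L2null_submod_closed : submod_closed L2null.
Proof.
split; first by apply/asboolP/aeW.
move=> a f g /asboolP f0 /asboolP g0; apply/asboolP.
move: f0 g0; apply: ae_imp2 => x f0 g0 xI.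
have -> : (a *: f + g) x = a * f x + g x :> R[i] by [].
by rewrite f0// g0// mulr0 addr0.
Qed.

HB.instance Definition _ :=
  GRing.isSubmodClosed.Build _ _ L2null L2null_submod_closed.

(* Square-integrable functions modulo equality almost everywhere on [0, 1]. *)
Definition L2 : Type := Quotient.quot L2null.

HB.instance Definition _ := Choice.on L2.
HB.instance Definition _ := GRing.Zmodule.on L2.
HB.instance Definition _ := Quotient.on L2.

Lemma L2_eqP (f g : L2fun) :
  \pi_L2 f = \pi_L2 g <-> \forall x \ae mu, I01 x -> f x = g x.
Proof.
have -> : (\pi_L2 f = \pi_L2 g) <-> (f - g \in L2null).
  by rewrite Quotient.idealrBE; split => [/eqP|/eqP].
split => [/asboolP|fg].
  by apply: ae_imp => x + xI => /(_ xI)/eqP; rewrite subr_eq0 => /eqP.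
by apply/asboolP; move: fg; apply: ae_imp => x + xI => /(_ xI) fg;
  apply/eqP; rewrite subr_eq0; apply/eqP.
Qed.

Lemma L2_ind (P : L2 -> Prop) : (forall f, P (\pi_L2 f)) -> forall u, P u.
Proof. by move=> Pf u; rewrite -[u]reprK. Qed.

Definition L2_scale (a : R[i]) (u : L2) : L2 := \pi_L2 (a *: repr u).

Lemma pi_L2_scale (a : R[i]) (f : L2fun) :
  L2_scale a (\pi_L2 f) = \pi_L2 (a *: f).
Proof.
apply/L2_eqP; have /L2_eqP : \pi_L2 (repr (\pi_L2 f)) = \pi_L2 f by rewrite reprK.
by apply: ae_imp => x + xI => /(_ xI) fx; congr (a *: _).
Qed.

Lemma pi_L2D (f g : L2fun) : \pi_L2 (f + g) = \pi_L2 f + \pi_L2 g.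
Proof. exact: (@Quotient.pi_add _ L2null f g). Qed.

Lemma L2_scaleA a b u : L2_scale a (L2_scale b u) = L2_scale (a * b) u.
Proof. by elim/L2_ind: u => f; rewrite !pi_L2_scale scalerA. Qed.

Lemma L2_scale1 : left_id 1 L2_scale.
Proof. by move=> u; elim/L2_ind: u => f; rewrite pi_L2_scale scale1r. Qed.

Lemma L2_scaleDr : right_distributive L2_scale +%R.
Proof.
move=> a u v; elim/L2_ind: u => f; elim/L2_ind: v => g.
by rewrite -pi_L2D !pi_L2_scale scalerDr pi_L2D.
Qed.

Lemma L2_scaleDl u : {morph L2_scale^~ u : a b / a + b}.
Proof.
move=> a b; elim/L2_ind: u => f.
by rewrite !pi_L2_scale scalerDl pi_L2D.
Qed.

HB.instance Definition _ := GRing.Zmodule_isLmodule.Build R[i] L2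
  L2_scaleA L2_scale1 L2_scaleDr L2_scaleDl.

Definition cintegral (D : set R) (f : R -> R[i]) : R[i] :=
  (\int[mu]_(t in D) Re (f t)) +i* (\int[mu]_(t in D) Im (f t)).

Lemma sq_integrable_integrable (f : R -> R[i]^o) : sq_integrable f ->
  mu.-integrable I01 (EFin \o (fun x => Re (f x))) /\
  mu.-integrable I01 (EFin \o (fun x => Im (f x))).
Proof.
move=> [mr mi i2].
have i1 : mu.-integrable I01
    (fun x => ((cst 1 x)%:E + (Re (f x) ^+ 2 + Im (f x) ^+ 2)%:E)%E).
  apply: integrableD => //.
  apply: continuous_compact_integrable; first exact: segment_compact.
  by apply: continuous_subspaceT => x; exact: cst_continuous.
split; apply: (le_integrable _ _ _ i1) => //; first exact/measurable_EFinP.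
- move=> x _; rewrite -EFinD !abse_EFin lee_fin; apply: le_trans (ler_norm _).
  set u := Re _; set v := Im _.
  by rewrite ler_norml; apply/andP; split; rewrite /=; nra.
- exact/measurable_EFinP.
- move=> x _; rewrite -EFinD !abse_EFin lee_fin; apply: le_trans (ler_norm _).
  set u := Re _; set v := Im _.
  by rewrite ler_norml; apply/andP; split; rewrite /=; nra.
Qed.

Lemma continuous_sq_integrable (f : R -> R[i]^o) :
  {within I01, continuous (fun x => Re (f x) : R)} ->
  {within I01, continuous (fun x => Im (f x) : R)} -> sq_integrable f.
Proof.
move=> cr ci; have mI : measurable I01 by [].
split.
- exact: subspace_continuous_measurable_fun.
- exact: subspace_continuous_measurable_fun.
- apply: (@continuous_compact_integrable R
    (fun x => Re (f x) ^+ 2 + Im (f x) ^+ 2)); first exact: segment_compact.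
  by move=> x; apply: cvgD; apply: cvgM; (exact: cr || exact: ci).
Qed.

Definition volterra_fun (f : R -> R[i]^o) : R -> R[i]^o :=
  fun x => cintegral `[0, x] f.

Definition volterra_adj_fun (f : R -> R[i]^o) : R -> R[i]^o :=
  fun x => cintegral `[x, 1] f.

Lemma within_volterra_fun (f : R -> R) :
  mu.-integrable I01 (EFin \o f) ->
  {within I01, continuous (fun x => \int[mu]_(t in `[0, x]) f t)}.
Proof. exact: parameterized_integral_continuous ler01. Qed.

Lemma within_volterra_adj_fun (f : R -> R) :
  mu.-integrable I01 (EFin \o f) ->
  {within I01, continuous (fun x => \int[mu]_(t in `[x, 1]) f t)}.
Proof.
move=> intf; pose g x : R := \int[mu]_(t in `[x, 1]) f t.
pose h x : R := \int[mu]_(t in I01) f t - \int[mu]_(t in `[0, x]) f t.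
have hg : {in I01, h =1 g}.
  move=> x; rewrite inE /= in_itv /= => /andP[x0 x1].
  rewrite /h Rintegral_itvB ?bnd_simp// /g Rintegral_itv_obnd_cbnd//.
  apply: integrableS intf => //.
  by apply: subset_itvr; rewrite bnd_simp.
have hc : {within I01, continuous h}.
  by move=> x; apply: cvgB; [exact: cvg_cst|exact: within_volterra_fun].
exact: (subspace_eq_continuous hg hc).
Qed.

Lemma volterra_fun_L2 (f : L2fun) : volterra_fun f \in L2pred.
Proof.
have /L2predP/sq_integrable_integrable[fr fi] := L2valP f.
by apply/L2predP/continuous_sq_integrable; exact: within_volterra_fun.
Qed.

Lemma volterra_adj_fun_L2 (f : L2fun) : volterra_adj_fun f \in L2pred.
Proof.
have /L2predP/sq_integrable_integrable[fr fi] := L2valP f.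
by apply/L2predP/continuous_sq_integrable; exact: within_volterra_adj_fun.
Qed.

(* Both operators are computed on a representative; [volterraE] and
   [volterra_adjE] below show that the choice does not matter. *)
Definition volterra (u : L2) : L2 :=
  \pi_L2 (MkL2fun (volterra_fun_L2 (repr u))).

Definition volterra_adj (u : L2) : L2 :=
  \pi_L2 (MkL2fun (volterra_adj_fun_L2 (repr u))).

Lemma cintegral_ae (D : set R) (f g : L2fun) :
  measurable D -> D `<=` I01 -> (\forall x \ae mu, I01 x -> f x = g x) ->
  cintegral D f = cintegral D g.
Proof.
move=> mD DI fg.
have /L2predP[fr fi _] := L2valP f; have /L2predP[gr gi _] := L2valP g.
congr (_ +i* _); congr fine; apply: ae_eq_integral => //.
- by apply/measurable_EFinP; apply: measurable_funS fr.
- by apply/measurable_EFinP; apply: measurable_funS gr.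
- by move: fg; apply: ae_imp => x /[swap] /DI xI /(_ xI) ->.
- by apply/measurable_EFinP; apply: measurable_funS fi.
- by apply/measurable_EFinP; apply: measurable_funS gi.
- by move: fg; apply: ae_imp => x /[swap] /DI xI /(_ xI) ->.
Qed.

Lemma volterraE (f : L2fun) :
  volterra (\pi_L2 f) = \pi_L2 (MkL2fun (volterra_fun_L2 f)).
Proof.
apply/L2_eqP/aeW => x; rewrite /= in_itv /= => /andP[x0 x1].
apply: cintegral_ae => //.
  by move=> t /=; rewrite !in_itv /= => /andP[? ?]; lra.
by apply/L2_eqP; rewrite reprK.
Qed.

Lemma volterra_adjE (f : L2fun) :
  volterra_adj (\pi_L2 f) = \pi_L2 (MkL2fun (volterra_adj_fun_L2 f)).
Proof.
apply/L2_eqP/aeW => x; rewrite /= in_itv /= => /andP[x0 x1].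
apply: cintegral_ae => //.
  by move=> t /=; rewrite !in_itv /= => /andP[? ?]; lra.
by apply/L2_eqP; rewrite reprK.
Qed.

Definition Re_volterra_pow (n : nat) (u : L2) : L2 :=
  2^-1 *: (iter n volterra u + iter n volterra_adj u).

Definition Im_volterra_pow (n : nat) (u : L2) : L2 :=
  (2 * 'i%C)^-1 *: (iter n volterra u - iter n volterra_adj u).
End L2.

Arguments Re_volterra_pow : clear implicits.
Arguments Im_volterra_pow : clear implicits.

Definition is_eigenvalue (K : fieldType) (E : lmodType K) (T : E -> E) (l : K) :=
  exists2 u : E, u != 0 & T u = l *: u.

(* Main.v *)
(* The operator V + V* maps f to the constant function with value the integral
   of f.  Hence V^n - (- V* )^n, which is V^n + V*^n or V^n - V*^n according to
   the parity of n, telescopes into an operator with range in the span of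
   1, V 1, ..., V^(n-1) 1.  Eigenvectors for non-zero eigenvalues lie in this
   span of dimension at most n, and those for distinct eigenvalues are linearly
   independent. *)
From HB Require Import structures.
Require Import Defs.
From mathcomp Require Import all_boot all_order all_algebra complex.
From mathcomp Require Import all_classical all_reals all_analysis.
From mathcomp Require Import generic_quotient.

Import Order.TTheory GRing.Theory Num.Theory.
Import numFieldNormedType.Exports.
Local Open Scope classical_set_scope.
Local Open Scope ring_scope.
Local Open Scope card_scope.

(** An infinite [A] contains a copy of the naturals; a finite one is equipotent to some [I_m], where
    cardinals compare as natural numbers. *)
Lemma not_card_le_II (T : Type) (A : set T) (n : nat) :
  ~~ (A #<= `I_n) -> `I_n.+1 #<= A.
Proof.
have [/finite_setP[m Am]|/infiniteP natA] := EM (finite_set A); last first.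
  by move=> _; apply: card_le_trans natA; exact: subset_card_le.
by rewrite (card_le_eql Am) (card_le_eqr Am) !card_le_II ltnNge.
Qed.

(** * Counting eigenvalues of an operator with finite-dimensional range *)

Section LinearAlgebra.
Context {K : fieldType} {E : lmodType K}.

(** Induction on [s]: applying [T - l0] to the relation kills the term of [l0] and multiplies the
    term of each other [l] by [l - l0], which is non-zero. *)
Lemma eigenvectors_free (T : {linear E -> E}) (s : seq K) (u : K -> E) :
  uniq s -> (forall l, l \in s -> u l != 0) ->
  (forall l, l \in s -> T (u l) = l *: u l) ->
  forall c : K -> K, \sum_(l <- s) c l *: u l = 0 ->
  forall l, l \in s -> c l = 0.
Proof.
elim: s => [//|l0 s IHs] /= /andP[l0s us] u0 Tu c csum.
have cs l : l \in s -> c l = 0.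
  move=> ls; have /eqP : c l * (l - l0) = 0.
    have us0 m : m \in s -> u m != 0.
      by move=> ms; apply: u0; rewrite inE ms orbT.
    have Tus m : m \in s -> T (u m) = m *: u m.
      by move=> ms; apply: Tu; rewrite inE ms orbT.
    apply: (IHs us us0 Tus (fun l => c l * (l - l0))) => //.
    have : T (\sum_(l <- l0 :: s) c l *: u l)
         - l0 *: \sum_(l <- l0 :: s) c l *: u l = 0.
      by rewrite csum linear0 scaler0 subrr.
    rewrite linear_sum scaler_sumr -sumrB big_cons linearZ /= Tu ?mem_head//.
    rewrite !scalerA mulrC subrr add0r => sum0; rewrite -[RHS]sum0.
    rewrite [LHS]big_seq [RHS]big_seq; apply: eq_bigr => m ms.
    by rewrite linearZ /= Tus// !scalerA -scalerBl mulrBr [l0 * _]mulrC.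
  rewrite mulf_eq0 subr_eq0 => /orP[/eqP//|/eqP ll0].
  by rewrite -ll0 ls in l0s.
move=> l; rewrite inE => /orP[/eqP->|/cs//].
move: csum; rewrite big_cons big_seq big1 => [|m /cs->]; last first.
  by rewrite scale0r.
rewrite addr0 => /eqP; rewrite scaler_eq0 => /orP[/eqP//|ul0].
by rewrite (negPf (u0 _ (mem_head _ _))) in ul0.
Qed.

(** Otherwise [n.+1] distinct non-zero eigenvalues have eigenvectors in the span of [n] vectors;
    these are linearly dependent, against [eigenvectors_free]. *)
Lemma card_eigenvalues_le (T : {linear E -> E}) (n : nat) (e : nat -> E) :
  (forall u, exists c : nat -> K, T u = \sum_(i < n) c i *: e i) ->
  [set l : K | l != 0 /\ is_eigenvalue T l] #<= `I_n.
Proof.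
move=> spanT; apply: contraT => /not_card_le_II/pcard_surjP[g gsurj].
(* A section of the surjection [g] onto [I_n.+1]; it is injective because [g] undoes it. *)
have /choice[l lP] : forall j : 'I_n.+1, exists l,
    (l != 0 /\ is_eigenvalue T l) /\ g l = j.
  by move=> j; have [l Sl gl] := gsurj j (ltn_ord j); exists l.
have l_inj : injective l.
  by move=> i j lij; apply/val_inj; rewrite /= -(lP i).2 -(lP j).2 lij.
have /choice[c cP] : forall j, exists c : nat -> K,
    \sum_(i < n) c i *: e i != 0 /\
    T (\sum_(i < n) c i *: e i) = l j *: (\sum_(i < n) c i *: e i).
  move=> j; have [[lj0 [u u0 Tu]] _] := lP j.
  (* As [l j] is non-zero, [u] is [(l j)^-1 *: T u], hence lies in the span. *)
  have [c Tc] := spanT u; exists (fun i => (l j)^-1 * c i).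
  suff -> : \sum_(i < n) ((l j)^-1 * c i) *: e i = u by [].
  by under eq_bigr do rewrite -scalerA; rewrite -scaler_sumr -Tc Tu scalerK.
pose A := \matrix_(j < n.+1, i < n) c j i.
(* With more rows than columns, the rows of [A] satisfy a non-trivial relation [v]. *)
have /rowV0Pn[v /sub_kermxP vA /rV0Pn[j vj]] : kermx A != 0.
  rewrite -mxrank_eq0 mxrank_ker subn_eq0 -ltnNge ltnS.
  exact: rank_leq_col.
(* The inverse of [l], since [eigenvectors_free] indexes vectors by eigenvalues; the default [ord0]
   is never reached on values of [l]. *)
pose idx m := odflt ord0 [pick i | l i == m].
have idxK i : idx (l i) = i.
  rewrite /idx; case: pickP => [k /eqP/l_inj//|/(_ i)]; by rewrite eqxx.
suff /(_ _ (map_f l (mem_enum 'I_n.+1 j))) :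
    forall m, m \in [seq l i | i <- enum 'I_n.+1] -> v 0 (idx m) = 0.
  by rewrite idxK => vj0; rewrite vj0 eqxx in vj.
apply: (@eigenvectors_free T _ (fun m => \sum_(i < n) c (idx m) i *: e i)).
- by rewrite map_inj_uniq ?enum_uniq.
- by move=> _ /mapP[i _ ->]; rewrite idxK; exact: (cP i).1.
- by move=> _ /mapP[i _ ->]; rewrite idxK; exact: (cP i).2.
rewrite big_map big_enum /=.
under eq_bigr do rewrite idxK scaler_sumr.
(* After the exchange, the coefficient of [e i] is entry [i] of [v *m A], which is zero. *)
rewrite exchange_big big1 //= => i _.
under eq_bigr do rewrite scalerA; rewrite -scaler_suml.
have /rowP/(_ i) := vA; rewrite !mxE; under eq_bigr do rewrite mxE.
by move=> ->; rewrite scale0r.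
Qed.
End LinearAlgebra.

Lemma iter_linear (K : pzRingType) (E : lmodType K) (f : {linear E -> E})
    (n : nat) : linear (iter n f).
Proof. by move=> a u v; elim: n => //= n ->; rewrite linearP. Qed.

(** * Linearity of the Volterra operator and its adjoint; the telescoping identity *)

Section Volterra.
Variable R : realType.
Notation mu := (@lebesgue_measure R).
Notation I01 := (`[0, 1]%classic : set R).
Local Open Scope quotient_scope.
Local Open Scope complex_scope.

Lemma pi_L2P (a : R[i]) (f g : L2fun R) :
  a *: \pi_(L2 R) f + \pi_(L2 R) g = \pi_(L2 R) (a *: f + g).
Proof. by rewrite pi_L2D -pi_L2_scale. Qed.

Lemma L2_integrable (f : L2fun R) (D : set R) : measurable D -> D `<=` I01 ->
  mu.-integrable D (EFin \o (fun x => complex.Re (f x))) /\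
  mu.-integrable D (EFin \o (fun x => complex.Im (f x))).
Proof.
move=> mD DI; have /L2predP/sq_integrable_integrable[fr fi] := L2valP f.
by split; [apply: integrableS fr|apply: integrableS fi].
Qed.

Lemma cintegralP (D : set R) (a : R[i]) (f g : L2fun R) :
  measurable D -> D `<=` I01 ->
  cintegral D (a *: f + g) = a * cintegral D f + cintegral D g.
Proof.
move=> mD DI; have [fr fi] := L2_integrable f D mD DI.
have [gr gi] := L2_integrable g D mD DI.
have iZ (h : R -> R) (k : R) :
    mu.-integrable D (EFin \o h) ->
    mu.-integrable D (EFin \o (fun x => k * h x)).
  by move=> ih; exact: (@integrableZl _ _ _ mu D mD k (EFin \o h) ih).
have iD (h k : R -> R) :
    mu.-integrable D (EFin \o h) ->
    mu.-integrable D (EFin \o k) ->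
    mu.-integrable D (EFin \o (fun x => h x + k x)).
  move=> ih ik.
  exact: (@integrableD _ _ _ mu D mD (EFin \o h) (EFin \o k) ih ik).
(* Both parts are written as sums of real multiples, the minus sign going into the coefficient, so
   that additivity and homogeneity of the real integral apply. *)
have -> : cintegral D (a *: f + g) =
    (\int[mu]_(t in D) (complex.Re a * complex.Re (f t)
        + - complex.Im a * complex.Im (f t) + complex.Re (g t))) +i*
    (\int[mu]_(t in D) (complex.Re a * complex.Im (f t)
        + complex.Im a * complex.Re (f t) + complex.Im (g t))).
  congr (_ +i* _); apply: eq_Rintegral => t _.
    by rewrite [LHS]Defs.ReDc Defs.ReM mulNr.
  by rewrite [LHS]Defs.ImDc Defs.ImM.
rewrite !RintegralD//; try by [apply: iZ|apply: iD; apply: iZ].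
rewrite !RintegralZl// mulNr; case: a => a b /=.
by rewrite /cintegral; apply/eqP; rewrite eq_complex /= !eqxx.
Qed.

Lemma subset_itv0x (x : R) : I01 x -> `[0, x] `<=` I01.
Proof.
rewrite /= in_itv /= => /andP[_ x1] t /=; rewrite !in_itv /= => /andP[-> tx].
exact: le_trans x1.
Qed.

Lemma subset_itvx1 (x : R) : I01 x -> `[x, 1] `<=` I01.
Proof.
rewrite /= in_itv /= => /andP[x0 _] t /=; rewrite !in_itv /= => /andP[xt ->].
by rewrite (le_trans x0).
Qed.

Lemma volterra_linear : linear (@volterra R).
Proof.
move=> a u v; elim/L2_ind: u => f; elim/L2_ind: v => g.
rewrite pi_L2P !volterraE pi_L2P.
apply/L2_eqP/aeW => x xI; apply: cintegralP => //; exact: subset_itv0x.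
Qed.

Lemma volterra_adj_linear : linear (@volterra_adj R).
Proof.
move=> a u v; elim/L2_ind: u => f; elim/L2_ind: v => g.
rewrite pi_L2P !volterra_adjE pi_L2P.
apply/L2_eqP/aeW => x xI; apply: cintegralP => //; exact: subset_itvx1.
Qed.

HB.instance Definition _ :=
  GRing.isLinear.Build R[i] (L2 R) (L2 R) *:%R (@volterra R) volterra_linear.
HB.instance Definition _ := GRing.isLinear.Build R[i] (L2 R) (L2 R) *:%R
  (@volterra_adj R) volterra_adj_linear.

Lemma cst1_L2 : (cst 1 : R -> R[i]^o) \in @L2pred R.
Proof.
apply/L2predP/continuous_sq_integrable;
  by apply: continuous_subspaceT => x; exact: cst_continuous.
Qed.

Definition L2_one : L2 R := \pi_(L2 R) (MkL2fun cst1_L2).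

(** The intervals overlap only in the null set of the point [x], so the second may be taken open at
    [x]. *)
Lemma cintegral_itv_split (f : L2fun R) (x : R) : I01 x ->
  cintegral `[0, x] f + cintegral `[x, 1] f = cintegral I01 f.
Proof.
move=> xI; have /andP[x0 x1] : (0 <= x) && (x <= 1).
  by move: xI; rewrite /= in_itv.
have [fr fi] := L2_integrable f I01 (measurable_itv _) (@subset_refl _ _).
have xsub : `]x, 1] `<=` I01.
  apply: subset_trans (subset_itvx1 x xI).
  by apply: subset_itvr; rewrite bnd_simp.
have [gr gi] := L2_integrable f _ (measurable_itv _) xsub.
have split (h : R -> R) :
    mu.-integrable I01 (EFin \o h) -> mu.-integrable `]x, 1] (EFin \o h) ->
    \int[mu]_(t in `[0, x]) h t + \int[mu]_(t in `[x, 1]) h t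
    = \int[mu]_(t in I01) h t.
  move=> ih1 ih2; rewrite -Rintegral_itv_obnd_cbnd//.
  by rewrite -(Rintegral_itvB ih1) ?bnd_simp// addrC subrK.
by congr (_ +i* _); apply: split.
Qed.

Lemma volterra_add_adj (u : L2 R) :
  exists k : R[i], volterra u + volterra_adj u = k *: L2_one.
Proof.
elim/L2_ind: u => f; exists (cintegral I01 f).
rewrite volterraE volterra_adjE [_ *: _]pi_L2_scale -pi_L2D.
apply/L2_eqP/aeW => x xI.
have -> : (cintegral I01 f *: MkL2fun cst1_L2) x = cintegral I01 f * 1 by [].
rewrite mulr1; exact: cintegral_itv_split.
Qed.

(** Write W for the adjoint of V. The difference for [n.+1] is V applied to the difference for [n],
    plus [(-1) ^+ n] times (V + W) W^n u, a multiple of [L2_one]. *)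
Lemma volterra_pow_span (n : nat) (u : L2 R) : exists c : nat -> R[i],
  iter n (@volterra R) u - (-1) ^+ n *: iter n (@volterra_adj R) u
  = \sum_(i < n) c i *: iter i (@volterra R) L2_one.
Proof.
elim: n => [|n [c cE]].
  by exists (fun=> 0); rewrite big_ord0 /= expr0 scale1r subrr.
have [k kE] := volterra_add_adj (iter n (@volterra_adj R) u).
(* Applying V shifts the old coefficients by one; the freed index 0 takes the new multiple of
   [L2_one]. *)
exists (fun i => if i is i'.+1 then c i' else (-1) ^+ n * k).
rewrite big_ord_recl /= -scalerA -kE.
have -> : \sum_(i < n) c i *: iter (bump 0 i) (@volterra R) L2_one
    = volterra (\sum_(i < n) c i *: iter i (@volterra R) L2_one).
  by rewrite linear_sum; apply: eq_bigr => i _; rewrite linearZ.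
have VE (x y : L2 R) :
    volterra (x - (-1) ^+ n *: y) = volterra x - (-1) ^+ n *: volterra y.
  by rewrite linearB linearZ.
by rewrite -cE VE exprS mulN1r scaleNr opprK scalerDr [RHS]addrC addrA subrK.
Qed.

Lemma Re_volterra_pow_linear (n : nat) : linear (Re_volterra_pow R n).
Proof.
move=> a u v; rewrite /Re_volterra_pow !iter_linear addrACA -scalerDr.
by rewrite [LHS]scalerDr !scalerA mulrC.
Qed.

Lemma Im_volterra_pow_linear (n : nat) : linear (Im_volterra_pow R n).
Proof.
move=> a u v; rewrite /Im_volterra_pow !iter_linear opprD addrACA -scalerBr.
by rewrite [LHS]scalerDr !scalerA mulrC.
Qed.

HB.instance Definition _ (n : nat) := GRing.isLinear.Build R[i] (L2 R) (L2 R)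
  *:%R (Re_volterra_pow R n) (Re_volterra_pow_linear n).
HB.instance Definition _ (n : nat) := GRing.isLinear.Build R[i] (L2 R) (L2 R)
  *:%R (Im_volterra_pow R n) (Im_volterra_pow_linear n).

End Volterra.

Theorem theorem2p1 (R : realType) (n : nat) (hn : (1 <= n)%N) :
  (odd n ->
     [set l : R[i] | l != 0 /\ is_eigenvalue (Re_volterra_pow R n) l] #<= `I_n)
  /\
  (~~ odd n ->
     [set l : R[i] | l != 0 /\ is_eigenvalue (Im_volterra_pow R n) l] #<= `I_n).
Proof.
split=> odd_n.
  apply: (card_eigenvalues_le (Re_volterra_pow R n) n
    (fun i => iter i (@volterra R) (L2_one R))) => u.
  have [c cE] := volterra_pow_span R n u; exists (fun i => 2^-1 * c i).
  rewrite /Re_volterra_pow; under eq_bigr do rewrite -scalerA.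
  (* For odd [n] the sign turns the difference into the sum defining the real part; for even [n],
     below, it stays a difference. *)
  by rewrite -scaler_sumr -cE -signr_odd odd_n expr1 scaleN1r opprK.
apply: (card_eigenvalues_le (Im_volterra_pow R n) n
  (fun i => iter i (@volterra R) (L2_one R))) => u.
have [c cE] := volterra_pow_span R n u; exists (fun i => (2 * 'i%C)^-1 * c i).
rewrite /Im_volterra_pow; under eq_bigr do rewrite -scalerA.
by rewrite -scaler_sumr -cE -signr_odd (negPf odd_n) expr0 scale1r.
Qed.
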